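(* Let $\mathcal{A}$ be a finite alphabet, $E=\mathcal{A}^{\mathbb{N}}$ the full shift, $X\subseteq\mathcal{A}^{\mathbb{N}}$ a nonempty subshift, and $\mathcal{G}$ the golden-mean tree. Let $\rho=\frac{1+\sqrt5}{2}$. Then the entropies of the axial products $E\times X$ and $X\times E$ on $\mathcal{G}$ are \[ h(E\times X)=\frac{\log|\mathcal{P}(\mathbb{Z}_1,X)|}{\rho^3}+\frac{\log|\mathcal{P}(\mathbb{Z}_2,X)|}{\rho^2} \qquad\text{and}\qquad h(X\times E)=\sum_{i=1}^\infty\frac{\log|\mathcal{P}(\mathbb{Z}_i,X)|}{\rho^{i+3}}. \]
   Context: $\mathbb{N}=\{1,2,\dots\}$, $\mathbb{Z}_i=\{1,\dots,i\}$, and $\mathcal{P}(\mathbb{Z}_i,X)=\{(x_1,\dots,x_i):x\in X\}$. Let $\mathcal{T}_2$ be the free monoid on generators $f_1,f_2$, with root (identity) $\epsilon$ and word length $|\cdot|$. The golden-mean tree $\mathcal{G}\subseteq\mathcal{T}_2$ consists of $\epsilon$ and all words $f_{a_1}\cdots f_{a_k}$ ($k\ge1$, $a_j\in\{1,2\}$) with $M_{a_j,a_{j+1}}=1$ for $1\le j\le k-1$, where $M=\begin{bmatrix}1&1\\1&0\end{bmatrix}$ (that is, words with no two consecutive $f_2$'s). For $X_1,X_2\subseteq\mathcal{A}^{\mathbb{N}}$, the axial product $X_1\times X_2$ on $\mathcal{G}$ is the set of $x\in\mathcal{A}^{\mathcal{G}}$ such that for every $g\in\mathcal{G}$ and $i\in\{1,2\}$,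 the (finite or infinite) sequence $x_g,x_{gf_i},x_{gf_i^2},\dots$, taken over all $n\ge0$ with $gf_i^n\in\mathcal{G}$, is an element of $X_i$ if infinite, and an initial word of some element of $X_i$ if finite. With $\Delta_n^{\mathcal{G}}=\{g\in\mathcal{G}:|g|\le n\}$ and $\mathcal{P}(\Delta_n^{\mathcal{G}},Y)=\{(x_g)_{g\in\Delta_n^{\mathcal{G}}}:x\in Y\}$, the entropy of $Y\subseteq\mathcal{A}^{\mathcal{G}}$ is $h(Y)=\lim_{n\to\infty}\frac{\log|\mathcal{P}(\Delta_n^{\mathcal{G}},Y)|}{|\Delta_n^{\mathcal{G}}|}$. *)

(* Defs.v *)
(* MathComp / MathComp-Analysis *)
From HB Require Import structures.
From mathcomp Require Import all_boot all_order all_algebra.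
From mathcomp Require Import all_classical all_reals all_analysis.
Set Implicit Arguments.
Unset Strict Implicit.
Unset Printing Implicit Defensive.
Import Order.TTheory GRing.Theory Num.Theory.
Import numFieldNormedType.Exports.
Local Open Scope classical_set_scope.
Local Open Scope ring_scope.

(** One-sided sequences.  The index set {1, 2, ...} is represented by [nat], so
    the coordinate [x_k] is [x (k - 1)]. *)
Section Sequences.
Variable A : finType.
Implicit Type X : set (nat -> A).

Definition left_shift (x : nat -> A) : nat -> A := fun n => x n.+1.

Definition subshift X : Prop :=
  closed (X : set (prod_topology (fun _ : nat => discrete_topology A))) /\
  left_shift @` X `<=` X.

Definition initial_word X (w : seq A) : Prop :=
  exists2 x, X x & w = mkseq x (size w).

Definition words X (i : nat) : {set i.-tuple A} :=
  [set w : i.-tuple A | `[< initial_word X w >]].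

End Sequences.

(** Words in the free monoid on f_1, f_2 are sequences over ['I_2]; note the
    offset: the index 0 stands for f_1 and 1 for f_2. *)
Definition f1 : 'I_2 := ord0.

Definition golden_mx : 'M[nat]_2 :=
  \matrix_(i, j) nth 0%N (nth [::] [:: [:: 1; 1]; [:: 1; 0]]%N i) j.

Definition golden (w : seq 'I_2) : bool :=
  sorted (fun a b => golden_mx a b == 1%N) w.

Definition golden_tree : Type := {w : seq 'I_2 | golden w}.

Section AxialProduct.
Variable A : finType.

(** [ray x g i n] is the label of x at g f_i^n, or [None] if g f_i^n lies
    outside the tree. *)
Definition ray (x : golden_tree -> A) (g : golden_tree) (i : 'I_2) (n : nat) :
    option A :=
  omap x (insub (val g ++ nseq n i)).

(** A ray is infinite when it equals [Some \o s] for a sequence [s], and finite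
    when it equals [onth w] for a word [w]; since the tree is closed under
    prefixes, exactly one of the two occurs. *)
Definition axial_product (X1 X2 : set (nat -> A)) : set (golden_tree -> A) :=
  [set x | forall (g : golden_tree) (i : 'I_2),
     let Xi := if i == f1 then X1 else X2 in
     (forall s : nat -> A, (forall n, ray x g i n = Some (s n)) -> Xi s) /\
     (forall w : seq A, (forall n, ray x g i n = onth w n) ->
        initial_word Xi w)].

End AxialProduct.

(** The finite subtree of the words of the tree of length at most n. *)
Definition ball (n : nat) : finType := {w : n.-bseq 'I_2 | golden w}.

Definition ball_incl (n : nat) (g : ball n) : golden_tree :=
  exist (fun w : seq 'I_2 => golden w) (val (val g)) (valP g).

Section Entropy.
Variables (R : realType) (A : finType).

Definition patterns (n : nat) (Y : set (golden_tree -> A)) :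
    {set {ffun ball n -> A}} :=
  [set p : {ffun ball n -> A} |
    `[< exists2 x, Y x & p = [ffun g => x (ball_incl g)] >]].

Definition entropy_seq (Y : set (golden_tree -> A)) (n : nat) : R :=
  ln #|patterns n Y|%:R / #|ball n|%:R.

Definition entropy (Y : set (golden_tree -> A)) : R := limn (entropy_seq Y).

End Entropy.

Definition golden_ratio (R : realType) : R := (1 + Num.sqrt 5) / 2.

(* Main.v *)
Require Import Defs.
From HB Require Import structures.
From mathcomp Require Import all_boot all_order all_algebra.
From mathcomp Require Import all_classical all_reals all_analysis.
From mathcomp Require Import ring lra zify.
Set Implicit Arguments.
Unset Strict Implicit.
Unset Printing Implicit Defensive.
Import Order.TTheory GRing.Theory Num.Theory.
Import numFieldNormedType.Exports.
Local Open Scope classical_set_scope.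
Local Open Scope ring_scope.

(* Fix a direction i. Every vertex is uniquely h f_i^k with h not ending in f_i,
   so the tree is a disjoint union of chains, infinite for f_1 and of length two
   for f_2. By shift invariance, a labelling lies in the axial product of X (in
   direction i) with the full shift iff its restriction to each chain is read
   off a point of X, independently over the chains; hence the number of patterns
   on the ball of radius n is the product over heads h of the number of words of
   X of length |chain of h inside the ball|. There are fib (k+1) heads of length
   k for f_2, fib k for f_1 (one if k = 0), and the ball has fib (n+4) - 2
   vertices, so everything reduces to Binet's formula. For f_1 the logarithm is
   a convolution of fib with ln |words X i|; its rho-part is rho^(n+4) times the
   partial sum of the limit series, and its conjugate part is O(n). *)

(** * Splitting a word into the head of its chain and its position there *)

Definition f2 : 'I_2 := ord_max.

Definition ends (i : 'I_2) (w : seq 'I_2) : bool := ohead (rev w) == Some i.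

(** Length of the maximal block of letters [i] at the end of [w], hence the position of [w] on its
    chain; the part before it, [stem], is the head. *)
Definition run (i : 'I_2) (w : seq 'I_2) : nat := find (predC1 i) (rev w).

Definition stem (i : 'I_2) (w : seq 'I_2) : seq 'I_2 :=
  rev (drop (run i w) (rev w)).

Lemma ord2_cases (i : 'I_2) : i = f1 \/ i = f2.
Proof. by case: i => [[|[|//]] ?]; [left|right]; apply/val_inj. Qed.

Lemma golden_mxE (a b : 'I_2) :
  (golden_mx a b == 1%N) = (a == f1) || (b == f1).
Proof.
by case: (ord2_cases a) => ->; case: (ord2_cases b) => ->; rewrite mxE.
Qed.

Lemma goldenE w :
  golden w = sorted (fun a b : 'I_2 => (a == f1) || (b == f1)) w.
Proof. by apply: eq_sorted => a b; rewrite golden_mxE. Qed.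

Lemma ends_rcons i w a : ends i (rcons w a) = (a == i).
Proof. by rewrite /ends rev_rcons. Qed.

Lemma golden_rcons w a : golden (rcons w a) =
  golden w && ((a == f1) || ~~ ends f2 w).
Proof.
rewrite !goldenE; case/lastP: w => [|w b]; first by rewrite orbT.
rewrite ends_rcons; case: w => [|c w] /=; rewrite ?rcons_path ?last_rcons /=.
  by case: (ord2_cases a) => ->; case: (ord2_cases b) => ->.
by case: (ord2_cases a) => ->; case: (ord2_cases b) => ->.
Qed.

Lemma stem_run i w : stem i w ++ nseq (run i w) i = w.
Proof.
rewrite -[RHS]revK /stem /run; elim: (rev w) => [//|a s IH] /=.
case: eqVneq => [->|] /=; last by rewrite cats0.
by rewrite rev_cons -IH -cats1 -catA -[[:: i]]/(nseq 1 i) -nseqD addn1.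
Qed.

Lemma ends_stem i w : ~~ ends i (stem i w).
Proof.
rewrite /ends /stem revK /run; elim: (rev w) => [//|a s IH] /=.
by case: (eqVneq a i) => [_|ai] /=; [exact: IH|rewrite (inj_eq (@Some_inj _))].
Qed.

Lemma run_cat i h k : ~~ ends i h -> run i (h ++ nseq k i) = k.
Proof.
rewrite /ends /run rev_cat rev_nseq find_cat has_nseq /= eqxx andbF size_nseq.
by case: (rev h) => [|a s] /=; rewrite ?addn0 // => ai; rewrite ai addn0.
Qed.

Lemma stem_cat i h k : ~~ ends i h -> stem i (h ++ nseq k i) = h.
Proof.
move=> hi; have := stem_run i (h ++ nseq k i); rewrite (run_cat k hi).
by move/eqP; rewrite eqseq_cat ?eqxx ?andbT; [move/eqP|
  have := congr1 size (stem_run i (h ++ nseq k i));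
  rewrite !size_cat run_cat // => /addIn].
Qed.

(** The letter [f1] may follow any letter, so an [f1]-chain never ends; a second [f2] would follow
    an [f2], so an [f2]-chain stops at [k = 1]. *)
Lemma golden_chain i h k : ~~ ends i h ->
  golden (h ++ nseq k i) = golden h && ((i == f1) || (k <= 1)%N).
Proof.
move=> hi; elim: k => [|k IH]; first by rewrite cats0 orbT andbT.
rewrite -[k.+1]addn1 nseqD catA cats1 golden_rcons {}IH.
case: (ord2_cases i) hi => -> hi; first by rewrite !andbT.
case: k => [|k]; first by rewrite cats0 hi !andbT.
have -> : ends f2 (h ++ nseq k.+1 f2).
  by rewrite -[k.+1]addn1 nseqD catA cats1 ends_rcons.
by rewrite (_ : (f2 == f1) = false) //= addn1 !andbF.
Qed.

Lemma golden_stem i w : golden w -> golden (stem i w).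
Proof.
by rewrite -{1}(stem_run i w) golden_chain ?ends_stem // => /andP[].
Qed.

Lemma size_stem i w : (size (stem i w) <= size w)%N.
Proof. by rewrite -{2}(stem_run i w) size_cat leq_addr. Qed.

(** * Axial products as conditions on chains *)

Lemma initial_wordP (A : finType) (X : set (nat -> A)) (w : seq A) (a0 : A) :
  initial_word X w <->
  exists2 y, X y & forall k, (k < size w)%N -> nth a0 w k = y k.
Proof.
split=> [[y Xy ->]|[y Xy wy]]; exists y => //.
  by move=> k; rewrite size_mkseq => kw; rewrite nth_mkseq.
apply: (@eq_from_nth _ a0) => [|k kw]; first by rewrite size_mkseq.
by rewrite nth_mkseq// wy.
Qed.

Lemma subshift_iter (A : finType) (X : set (nat -> A)) (m : nat) (y : nat -> A) :
  @left_shift A @` X `<=` X -> X y -> X (fun k => y (m + k)%N).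
Proof.
move=> Xs Xy; elim: m => [//|m IH]; apply: Xs.
by exists (fun k => y (m + k)%N) => //; apply/funext => k;
   rewrite /left_shift addSnnS.
Qed.

(** A finite chain constrains only an initial segment of [y], so finite and infinite chains are
    treated alike. *)
Definition chain_product (A : finType) (i : 'I_2) (X : set (nat -> A)) :
    set (golden_tree -> A) :=
  [set x | forall h, golden h -> ~~ ends i h -> exists2 y, X y &
     forall k (g : golden_tree), val g = h ++ nseq k i -> x g = y k].

Lemma rayE (A : finType) (x : golden_tree -> A) (g g' : golden_tree) i k :
  val g' = val g ++ nseq k i -> ray x g i k = Some (x g').
Proof. by move=> gg'; rewrite /ray -gg' valK. Qed.

Lemma ray_None (A : finType) (x : golden_tree -> A) (g : golden_tree) i k :
  ~~ golden (val g ++ nseq k i) -> ray x g i k = None.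
Proof. by move=> gN; rewrite /ray insubN. Qed.

Lemma ray_Some (A : finType) (x : golden_tree -> A) (g : golden_tree) i k a :
  ray x g i k = Some a ->
  exists2 g' : golden_tree, val g' = val g ++ nseq k i & x g' = a.
Proof. by rewrite /ray; case: insubP => //= g' _ gg' [<-]; exists g'. Qed.

Definition node w (gw : golden w) : golden_tree :=
  exist (fun w => golden w : Prop) w gw.

(** A chain is the ray from its head. Conversely, the ray from [g] is a tail of the chain through
    [g], so a shift of the point read along that chain serves for the ray. *)
Lemma axial_productE (A : finType) (X1 X2 : set (nat -> A)) :
  X1 !=set0 -> @left_shift A @` X1 `<=` X1 -> @left_shift A @` X2 `<=` X2 ->
  axial_product X1 X2 = chain_product f1 X1 `&` chain_product f2 X2.
Proof.
move=> [y0 _] X1s X2s; have a0 := y0 0%N.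
apply/seteqP; split=> [x xX|x [x1 x2] g i].
  split=> h gh hi; pose g : golden_tree := node gh.
    have gk k : golden (val g ++ nseq k f1) by rewrite golden_chain ?gh.
    pose s k := x (node (gk k)).
    exists s => [|k g' gg']; last by congr x; apply/val_inj.
    by apply: (xX g f1).1 => n; exact: rayE.
  have gk : golden (val g ++ nseq 1 f2) by rewrite golden_chain ?gh.
  (* The [f2]-chain of [h] has exactly two vertices, so its finite ray spells this word. *)
  pose w := [:: x g; x (node gk)].
  have [|y Xy wy] := (initial_wordP _ w a0).1 ((xX g f2).2 w _).
    move=> [|[|n]]; [by apply: rayE; rewrite cats0|exact: rayE|].
    by rewrite ray_None; [case: n|rewrite golden_chain ?gh].
  exists y => // k g' gg'; have : golden (h ++ nseq k f2) by rewrite -gg' valP.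
  rewrite golden_chain ?gh //=; case: k gg' => [|[|//]] gg' _.
    by rewrite -wy //=; congr x; apply/val_inj; rewrite gg' cats0.
  by rewrite -wy //=; congr x; apply/val_inj; rewrite gg'.
cbv zeta; set Xi := if _ then _ else _.
have Xis : @left_shift A @` Xi `<=` Xi by rewrite /Xi; case: ifP.
have [y Xy xy] : exists2 y, Xi y &
    forall k a, ray x g i k = Some a -> a = y k.
  have gstem := golden_stem i (valP g).
  have [y Xy xy] : exists2 y, Xi y & forall k (g' : golden_tree),
      val g' = stem i (val g) ++ nseq k i -> x g' = y k.
    by rewrite /Xi; case: (ord2_cases i) gstem => -> /= gstem;
       [apply: x1|apply: x2] => //; exact: ends_stem.
  exists (fun k => y (run i (val g) + k)%N); first exact: subshift_iter.
  move=> k a /ray_Some[g' gg' <-]; apply: xy.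
  by rewrite gg' nseqD catA stem_run.
split=> [s rs|w rw].
  by rewrite (_ : s = y) //; apply/funext => n; exact: xy.
apply/(initial_wordP _ _ a0); exists y => // k kw; apply: xy.
by rewrite rw onthE (nth_map a0).
Qed.

Lemma chain_productT (A : finType) (a0 : A) (i : 'I_2) :
  chain_product i [set: nat -> A] = [set: golden_tree -> A].
Proof.
apply/seteqP; split=> // x _ h gh hi.
(* The letter [a0] fills the positions beyond the end of a finite chain. *)
exists (fun k => odflt a0 (omap x (insub (h ++ nseq k i)))) => // k g gg'.
by rewrite -gg' valK.
Qed.

(** * Counting the patterns on a ball chain by chain *)

Definition chain_len (i : 'I_2) (n s : nat) : nat :=
  (if i == f1 then n.+1 - s else minn 2 (n.+1 - s))%N.

(** For heads longer than [n] the truncated subtraction in [chain_len] yields length 0, in agreement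
    with the right-hand side. *)
Lemma chain_lenP i n h k : golden h -> ~~ ends i h ->
  (k < chain_len i n (size h))%N = golden (h ++ nseq k i) && (size h + k <= n)%N.
Proof.
move=> gh hi; rewrite golden_chain// gh /chain_len.
by case: eqP => _ /=; lia.
Qed.

Lemma chain_len_leq i n s : (chain_len i n s <= n.+1)%N.
Proof. by rewrite /chain_len; case: eqP => _; lia. Qed.

Definition bword n (g : Defs.ball n) : seq 'I_2 := val (val g).

Lemma bword_inj n : injective (@bword n).
Proof. by move=> g g' /val_inj/val_inj. Qed.

Definition bnode n w (gw : golden w) (nw : (size w <= n)%N) : Defs.ball n :=
  exist (fun w : n.-bseq 'I_2 => golden w : Prop) (Bseq nw) gw.

Lemma golden_bword n (g : Defs.ball n) : golden (bword g).
Proof. exact: valP g. Qed.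

Lemma size_bword n (g : Defs.ball n) : (size (bword g) <= n)%N.
Proof. exact: size_bseq. Qed.

Definition bstem i n (g : Defs.ball n) : Defs.ball n :=
  bnode (golden_stem i (golden_bword g))
        (leq_trans (size_stem i _) (size_bword g)).

Lemma bword_bstem i n (g : Defs.ball n) : bword (bstem i g) = stem i (bword g).
Proof. by []. Qed.

Lemma run_lt_chain_len i n (g : Defs.ball n) :
  (run i (bword g) < chain_len i n (size (stem i (bword g))))%N.
Proof.
rewrite chain_lenP ?golden_stem ?golden_bword ?ends_stem// stem_run golden_bword.
have := size_bword g; rewrite -{1}(stem_run i (bword g)) size_cat size_nseq.
by [].
Qed.

Section PatternCount.
Variables (A : finType) (a0 : A) (X : set (nat -> A)) (i : 'I_2) (n : nat).
Hypothesis X_neq0 : X !=set0.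

(** Chain lengths vary with the head, so all words are placed in one finite type, of length at most
    [n.+1]. A vertex that is not a head admits one word and contributes a factor 1. *)
Definition chain_words (h : Defs.ball n) : pred (n.+1.-bseq A) :=
  fun w => if ends i (bword h) then size w == 0
           else (size w == chain_len i n (size (bword h))) && `[< initial_word X w >].

(* A pattern is encoded by the word read along each chain, stored at its head;
   vertices that are not heads carry the empty word. *)
Definition glue (phi : {ffun Defs.ball n -> n.+1.-bseq A}) :
    {ffun Defs.ball n -> A} :=
  [ffun g => nth a0 (phi (bstem i g)) (run i (bword g))].

Lemma glueE phi (g h : Defs.ball n) k : ~~ ends i (bword h) ->
  bword g = bword h ++ nseq k i -> glue phi g = nth a0 (phi h) k.
Proof.
move=> hi gh; rewrite ffunE gh run_cat//; congr (nth _ (phi _) _).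
by apply: bword_inj; rewrite bword_bstem gh stem_cat.
Qed.

(** Each position below [chain_len] on the chain of a head is a vertex of the ball, so the glued
    pattern displays every letter of every word. *)
Lemma glue_inj : {in family chain_words &, injective glue}.
Proof.
move=> phi psi /familyP phiF /familyP psiF glueE2; apply/ffunP => h.
apply/val_inj => /=; move: (phiF h) (psiF h).
rewrite !unfold_in /chain_words; case: ifPn => [_|hi].
  by move=> /nilP -> /nilP ->.
move=> /andP[/eqP sphi _] /andP[/eqP spsi _].
apply: (@eq_from_nth _ a0); rewrite sphi// => k.
rewrite chain_lenP ?golden_bword// => /andP[gk nk].
have nk' : (size (bword h ++ nseq k i) <= n)%N by rewrite size_cat size_nseq.
by rewrite -!(@glueE _ (bnode gk nk') _ _ hi)// glueE2.
Qed.

(** One inclusion cuts each chain to its part in the ball. The other extends a pattern to the whole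
    tree: every word stored at a head begins a point of [X]. *)
Lemma patterns_chain_product :
  patterns n (chain_product i X) = (glue @: family chain_words)%SET.
Proof.
have [y0 Xy0] := X_neq0.
apply/setP => p; rewrite inE; apply/asboolP/imsetP => [[x xX ->]|].
  have yP (h : Defs.ball n) : exists y, X y /\ (~~ ends i (bword h) ->
      forall k (g : golden_tree), val g = bword h ++ nseq k i -> x g = y k).
    have [hi|hi] := boolP (ends i (bword h)); first by exists y0.
    by have [y Xy xy] := xX _ (golden_bword h) hi; exists y.
  have [y {yP}yP] := choice yP.
  pose len (h : Defs.ball n) :=
    if ends i (bword h) then 0%N else chain_len i n (size (bword h)).
  have len_leq h : (size (mkseq (y h) (len h)) <= n.+1)%N.
    by rewrite size_mkseq /len; case: ifP => // _; exact: chain_len_leq.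
  exists [ffun h => Bseq (len_leq h)].
    apply/familyP => h; rewrite ffunE unfold_in /chain_words/= size_mkseq /len.
    have [//|hi] := boolP (ends i (bword h)); rewrite eqxx; apply/asboolP.
    by exists (y h); [exact: (yP h).1|rewrite size_mkseq].
  apply/ffunP => g; rewrite !ffunE /= /len bword_bstem (negbTE (ends_stem _ _)).
  rewrite nth_mkseq ?run_lt_chain_len//; apply: (yP _).2; first exact: ends_stem.
  by rewrite bword_bstem stem_run.
move=> [phi /familyP phiF ->].
(* A point is chosen for every word, inside the ball or not, since the extension must label the
   whole tree; [y0] serves where the pattern imposes nothing. *)
have yP (w : seq 'I_2) : exists y, X y /\ forall h : Defs.ball n, bword h = w ->
    ~~ ends i w -> forall k, (k < chain_len i n (size w))%N ->
      nth a0 (phi h) k = y k.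
  have [[h hw]|wN] := pselect (exists h : Defs.ball n, bword h = w); last first.
    by exists y0; split=> // h hw; case: wN; exists h.
  have [hi|hi] := boolP (ends i w); first by exists y0.
  have := phiF h; rewrite unfold_in /chain_words hw (negbTE hi).
  case/andP=> /eqP sphi /asboolP /(initial_wordP _ _ a0)[y Xy yphi].
  exists y; split=> // h' h'w _ k kn.
  by rewrite (_ : h' = h) ?yphi ?sphi//; apply: bword_inj; rewrite hw.
have [y {yP}yP] := choice yP.
exists (fun g => y (stem i (val g)) (run i (val g))).
  move=> h gh hi; exists (y h); first exact: (yP h).1.
  by move=> k g ->; rewrite stem_cat// run_cat.
apply/ffunP => g; rewrite !ffunE /=.
have [_ /(_ (bstem i g) (bword_bstem i g)) ->//] := yP (stem i (bword g)).
  exact: ends_stem.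
exact: run_lt_chain_len.
Qed.

Lemma card_chain_words (h : Defs.ball n) : #|chain_words h| =
  if ends i (bword h) then 1%N else #|words X (chain_len i n (size (bword h)))|.
Proof.
rewrite /chain_words; case: ifPn => hi.
  rewrite (@fintype.eq_card1 _ (Bseq (isT : (size (@nil A) <= n.+1)%N)))// => w.
  by rewrite !inE -val_eqE; case: w => [[|a w]].
have ln := chain_len_leq i n (size (bword h)); move: ln.
move: (chain_len i n (size (bword h))) => m mn.
have mP (t : m.-tuple A) : (size t <= n.+1)%N by rewrite size_tuple.
pose f (t : m.-tuple A) : n.+1.-bseq A := Bseq (mP t).
have f_inj : injective f by move=> t t' [] /val_inj.
rewrite -(card_imset _ f_inj); apply: fintype.eq_card => w; rewrite unfold_in.
apply/andP/imsetP => [[/eqP sw Xw]|[t + ->]].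
  exists (Tuple (introT eqP sw)); first by rewrite inE.
  exact/val_inj.
by rewrite inE => Xt; rewrite size_tuple eqxx.
Qed.

Lemma card_patterns : #|patterns n (chain_product i X)| =
  (\prod_(h : Defs.ball n | ~~ ends i (bword h))
     #|words X (chain_len i n (size (bword h)))|)%N.
Proof.
rewrite patterns_chain_product card_in_imset; last exact: glue_inj.
rewrite card_family foldrE big_map big_enum [RHS]big_mkcond .
by apply: eq_bigr => h _; rewrite card_chain_words; case: ifP.
Qed.
End PatternCount.

(** * Counting heads by length with Fibonacci numbers *)

Fixpoint gwords (k : nat) : seq (seq 'I_2) :=
  if k is k'.+1 then
    [seq rcons w f1 | w <- gwords k'] ++
    [seq rcons w f2 | w <- gwords k' & ~~ ends f2 w]
  else [:: [::]].

Lemma rcons_injr (T : Type) (a : T) : injective (fun w : seq T => rcons w a).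
Proof. by move=> u v /rcons_inj[]. Qed.

Lemma mem_gwords k w : (w \in gwords k) = golden w && (size w == k).
Proof.
elim: k w => [|k IH] w /=; first by rewrite inE; case: w => [|? ?]; rewrite ?andbF.
rewrite mem_cat; case/lastP: w => [|w a].
  by apply/norP; split; apply/mapP => -[[|? ?]].
rewrite golden_rcons size_rcons eqSS; case: (ord2_cases a) => ->.
  rewrite (mem_map (@rcons_injr _ f1)) IH andbT orb_idr//.
  by case/mapP => v _ /rcons_inj[_ /eqP].
rewrite orb_idl; last by case/mapP => v _ /rcons_inj[_ /eqP].
rewrite (mem_map (@rcons_injr _ f2)) mem_filter IH /=.
by rewrite andbA [_ && golden w]andbC.
Qed.

Lemma gwords_uniq k : uniq (gwords k).
Proof.
elim: k => [//|k IH] /=; rewrite cat_uniq !map_inj_uniq ?filter_uniq ?IH//;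
  try exact: rcons_injr.
rewrite andbT; apply/hasPn => _ /mapP[w _ ->]; apply/mapP => -[v _].
by move=> /rcons_inj[_ /eqP].
Qed.

(** Passage from vertices to depths: [bword] maps the vertices of length [k] bijectively onto
    [gwords k]. *)
Lemma sum_ball (V : nmodType) (P : pred (seq 'I_2)) (F : nat -> V) n :
  \sum_(h : Defs.ball n | P (bword h)) F (size (bword h)) =
  \sum_(k < n.+1) F k *+ count P (gwords k).
Proof.
pose s (h : Defs.ball n) : 'I_n.+1 := Ordinal (size_bword h : (_ < n.+1)%N).
rewrite (partition_big s predT)//=; apply: eq_bigr => k _.
have gk : perm_eq [seq bword h | h <- enum (Defs.ball n) & s h == k] (gwords k).
  apply: uniq_perm; last 1 first.
  - move=> w; rewrite mem_gwords; apply/mapP/andP => [[h]|[gw /eqP sw]].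
      rewrite mem_filter => /andP[/eqP <- _] ->.
      by rewrite golden_bword eqxx.
    have nw : (size w <= n)%N by rewrite sw -ltnS.
    exists (bnode gw nw) => //; rewrite mem_filter mem_enum andbT.
    by apply/eqP/val_inj.
  - rewrite (map_inj_uniq (@bword_inj n)) filter_uniq//.
    exact: enum_uniq.
  - exact: gwords_uniq.
rewrite -sum1_count -sumrMnr -(perm_big _ gk) /=.
rewrite big_map big_filter_cond big_enum_cond.
apply: eq_big => [h|h /andP[_ /eqP <-]]; last by rewrite mulr1n.
by rewrite andbC.
Qed.

Fixpoint fib (n : nat) : nat :=
  if n is n'.+1 then if n' is n''.+1 then fib n' + fib n'' else 1%N else 0%N.

Arguments fib : simpl never.

Lemma fibSS n : fib n.+2 = (fib n.+1 + fib n)%N.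
Proof. by []. Qed.

(** The two counts need one induction: words not ending in [f2] arise by appending [f1] to any word,
    the others by appending [f2] to a word not ending in [f2]. *)
Lemma fib_counts k :
  size (gwords k) = fib k.+2 /\ count (fun w => ~~ ends f2 w) (gwords k) = fib k.+1.
Proof.
elim: k => [//|k [s2 c2]].
rewrite [fib k.+3]fibSS /= size_cat !size_map size_filter c2 s2; split=> //.
rewrite count_cat !count_map -s2 -[RHS]addn0; congr (_ + _)%N.
  rewrite -[RHS]count_predT; apply: eq_count => w /=; by rewrite ends_rcons.
by rewrite (@eq_count _ _ pred0) ?count_pred0// => w /=; rewrite ends_rcons.
Qed.

Lemma size_gwords k : size (gwords k) = fib k.+2.
Proof. exact: (fib_counts k).1. Qed.

Lemma count_gwords2 k : count (fun w => ~~ ends f2 w) (gwords k) = fib k.+1.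
Proof. exact: (fib_counts k).2. Qed.

(** A nonempty word not ending in [f1] is a word not ending in [f2] followed by [f2]. The root
    escapes this rule, whence the index [k.+1]. *)
Lemma count_gwords1 k : count (fun w => ~~ ends f1 w) (gwords k.+1) = fib k.+1.
Proof.
rewrite count_cat !count_map -count_gwords2 -[RHS]size_filter.
rewrite (@eq_count _ _ pred0) ?count_pred0 => [|w /=]; last by rewrite ends_rcons.
rewrite (@eq_count _ _ predT) ?count_predT// => w /=.
by rewrite ends_rcons.
Qed.

Lemma sum_fib n : (\sum_(k < n) fib k.+1)%N = (fib n.+2).-1.
Proof.
have fib_gt0 m : (0 < fib m.+1)%N by elim: m => // m IH; rewrite fibSS addn_gt0 IH.
elim: n => [|n IH]; first by rewrite big_ord0.
by rewrite big_ord_recr IH /= [fib n.+3]fibSS; have := fib_gt0 n.+1; lia.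
Qed.

Lemma card_ball n : #|Defs.ball n| = ((fib n.+4).-2)%N.
Proof.
rewrite -sum1_card (sum_ball xpredT (fun=> 1%N)) /=.
under eq_bigr do rewrite count_predT size_gwords.
(* The sum starts at [fib 2]; restoring the term [fib 1 = 1] completes it and accounts for the
   second unit subtracted. *)
have := sum_fib n.+2; rewrite big_ord_recl /= add1n => <-.
by apply: eq_bigr => k _; rewrite natn.
Qed.

Lemma card_ball_gt0 n : (0 < #|Defs.ball n|)%N.
Proof.
by apply/card_gt0P; exists (@bnode n [::] isT (leq0n n)).
Qed.

(** * Logarithm of the pattern count as a sum over depths *)

Lemma card_words_gt0 (A : finType) (X : set (nat -> A)) m :
  X !=set0 -> (0 < #|words X m|)%N.
Proof.
move=> [y Xy]; apply/card_gt0P.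
have sm : size (mkseq y m) == m by rewrite size_mkseq.
by exists (Tuple sm); rewrite inE; apply/asboolP; exists y; rewrite //= size_mkseq.
Qed.

Lemma ln_card_patterns (R : realType) (A : finType) (X : set (nat -> A)) i n :
  X !=set0 -> ln #|patterns n (chain_product i X)|%:R =
  \sum_(k < n.+1) ln (#|words X (chain_len i n k)|%:R : R) *+
     count (fun w => ~~ ends i w) (gwords k).
Proof.
move=> X_neq0; have [y0 Xy0] := X_neq0.
rewrite (card_patterns (y0 0%N))// natr_prod.
rewrite -(sum_ball (fun w => ~~ ends i w)
  (fun k => ln #|words X (chain_len i n k)|%:R)).
have h0 (s : seq (Defs.ball n)) (P : pred (Defs.ball n)) (f : Defs.ball n -> nat) :
    (forall h, 0 < f h)%N ->
    ln (\prod_(h <- s | P h) (f h)%:R) = \sum_(h <- s | P h) ln (f h)%:R :> R.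
  move=> f0; elim: s => [|h s IH]; first by rewrite !big_nil ln1.
  rewrite !big_cons; case: ifP => // _; rewrite lnM ?IH// posrE ?ltr0n//.
  by apply: prodr_gt0 => k _; rewrite ltr0n.
by apply: h0 => h; exact: card_words_gt0.
Qed.

(** * Binet's formula and limits involving the golden ratio *)

Section GoldenAsymptotics.
Variable R : realType.
Local Notation rho := (golden_ratio R).

Lemma golden_ratio_sqr : rho ^+ 2 = rho + 1.
Proof.
have s5 : Num.sqrt 5 ^+ 2 = 5 :> R by rewrite sqr_sqrtr// ler0n.
by rewrite /golden_ratio; lra.
Qed.

Lemma golden_ratio_gt1 : 1 < rho.
Proof.
have : 1 < Num.sqrt 5 :> R by rewrite -{1}sqrtr1 ltr_sqrt ?ltr0n// ltr1n.
by rewrite /golden_ratio; lra.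
Qed.

Lemma golden_ratio_gt0 : 0 < rho.
Proof. exact: lt_trans ltr01 golden_ratio_gt1. Qed.

Lemma golden_ratio_neq0 : rho != 0.
Proof. by rewrite gt_eqF ?golden_ratio_gt0. Qed.

Lemma golden_ratioV : rho^-1 = rho - 1.
Proof.
apply: (mulfI golden_ratio_neq0); rewrite mulfV ?golden_ratio_neq0//.
have := golden_ratio_sqr; lra.
Qed.

(** Here [1 - rho] is the conjugate root of [x^2 = x + 1], and [2 * rho - 1] is the square root of
    5. *)
Lemma binet n : (fib n)%:R * (2 * rho - 1) = rho ^+ n - (1 - rho) ^+ n :> R.
Proof.
have [] : (fib n)%:R * (2 * rho - 1) = rho ^+ n - (1 - rho) ^+ n /\
    (fib n.+1)%:R * (2 * rho - 1) = rho ^+ n.+1 - (1 - rho) ^+ n.+1 => //.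
elim: n => [|n [IH1 IH2]]; first by rewrite /fib !expr0 !expr1; split; ring.
split=> //; rewrite fibSS natrD mulrDl IH1 IH2 !exprS.
by ring: golden_ratio_sqr.
Qed.

(** The limit [rho ^+ 3] is [x / (1 - x)^2] at [x = 1 / rho], where [1 - x = x^2]. This series later
    dominates the one in the entropy. *)
Lemma sum_mulrn_golden n : \sum_(k < n) k.+1%:R / rho ^+ k.+1 =
  rho ^+ 3 - (n%:R * rho + rho ^+ 3) / rho ^+ n :> R.
Proof.
elim: n => [|n IH]; first by rewrite big_ord0 mul0r add0r expr0 divr1 subrr.
rewrite big_ord_recr /= IH [rho ^+ n.+1]exprS invfM -natr1.
rewrite golden_ratioV; set w := (rho ^+ n)^-1.
by ring: golden_ratio_sqr.
Qed.

Lemma sum_mulrn_golden_le n :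
  \sum_(k < n) k.+1%:R / rho ^+ k.+1 <= rho ^+ 3 :> R.
Proof.
have r0 := golden_ratio_gt0; rewrite sum_mulrn_golden lerBlDr lerDl.
by rewrite divr_ge0 ?exprn_ge0 ?addr_ge0 ?mulr_ge0 ?ler0n ?exprn_ge0 ?ltW.
Qed.

(** These are, up to a shift, the terms of a series whose partial sums increase and stay below
    [rho ^+ 3]. *)
Lemma cvg_natr_golden : (fun n : nat => n%:R / rho ^+ n : R) @ \oo --> (0 : R).
Proof.
have r0 := golden_ratio_gt0.
rewrite -cvg_shiftS; apply: cvg_series_cvg_0.
apply: nondecreasing_is_cvgn.
  apply/nondecreasing_seqP => n; rewrite /series /= big_nat_recr//= lerDl.
  by rewrite divr_ge0 ?ler0n ?exprn_ge0 ?ltW.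
exists (rho ^+ 3) => _ [n _ <-]; rewrite /series /= big_mkord.
exact: sum_mulrn_golden_le.
Qed.

Lemma norm_golden_ratioV_lt1 : `|rho^-1| < 1.
Proof.
rewrite ger0_norm ?invr_ge0 ?ltW ?golden_ratio_gt0//.
by rewrite invf_cp1 ?golden_ratio_gt0 ?golden_ratio_gt1.
Qed.

Lemma cvg_expr_golden0 : (fun n : nat => (rho ^+ n)^-1 : R) @ \oo --> (0 : R).
Proof.
have := cvg_expr norm_golden_ratioV_lt1; apply: cvg_trans; apply: near_eq_cvg.
by apply: nearW => n; rewrite exprVn.
Qed.

Lemma cvg_expr_conj : (fun n : nat => ((1 - rho) ^+ n) : R) @ \oo --> (0 : R).
Proof.
by apply: cvg_expr; rewrite distrC -golden_ratioV norm_golden_ratioV_lt1.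
Qed.

Lemma cvg_fib : (fun n : nat => (fib n)%:R / rho ^+ n : R) @ \oo -->
  (2 * rho - 1)^-1.
Proof.
have d0 : 2 * rho - 1 != 0 by rewrite gt_eqF//; have := golden_ratio_gt1; lra.
rewrite (_ : (fun _ => _) = fun n : nat => (2 * rho - 1)^-1 *
    (1 - (1 - rho) ^+ n * (rho ^+ n)^-1)); last first.
  apply/funext => n; apply: (mulfI d0); rewrite mulrA [RHS]mulrA mulfV// mul1r.
  rewrite [_ * _%:R]mulrC binet mulrBl mulfV//.
  by rewrite expf_neq0// golden_ratio_neq0.
rewrite -[X in _ --> X]mulr1; apply: cvgMr.
rewrite -[X in _ --> X]subr0; apply: cvgB; first exact: cvg_cst.
rewrite -[X in _ --> X](mulr0 0).
by apply: cvgM; [exact: cvg_expr_conj|exact: cvg_expr_golden0].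
Qed.

End GoldenAsymptotics.

(** * Convolutions of a linearly bounded sequence with powers *)

Section ConvolutionAsymptotics.
Variables (R : realType) (L : nat -> R) (C : R).
Hypotheses (C_ge0 : 0 <= C) (L_bnd : forall m, 0 <= L m <= m%:R * C).
Local Notation rho := (golden_ratio R).

(** Binet's formula turns the convolution with [fib] into the difference of the cases [c = rho] and
    [c = 1 - rho], divided by [2 * rho - 1]. *)
Definition conv (c : R) (n : nat) : R := \sum_(k < n) c ^+ k.+1 * L (n - k)%N.

Lemma convS c n : conv c n.+1 = c * (conv c n + L n.+1).
Proof.
rewrite /conv big_ord_recl /= expr1 subn0 addrC mulrDr; congr (_ + _).
rewrite big_distrr /=; apply: eq_bigr => k _.
by rewrite /bump /= add1n subSS [c ^+ _.+2]exprS mulrA.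
Qed.

(** With [i = n - k], the weight [rho ^+ k.+1] equals [rho ^+ (n + 4) / rho ^+ (i + 3)]; the power
    [n + 4] is the growth of the ball. *)
Lemma conv_golden n :
  conv rho n = rho ^+ (n + 4) * \sum_(1 <= i < n.+1) L i / rho ^+ (i + 3).
Proof.
have r0 := golden_ratio_neq0 R.
elim: n => [|n IH]; first by rewrite /conv big_ord0 big_geq// mulr0.
rewrite convS IH [in RHS]big_nat_recr//= !mulrDr; congr (_ + _).
  by rewrite mulrA -exprS.
rewrite mulrCA [LHS]mulrC; congr (_ * _).
rewrite (_ : n.+1 + 4 = (n.+1 + 3).+1)%N; last by rewrite addnS.
by rewrite exprS mulfK// expf_neq0.
Qed.

Lemma norm_conv_conj n : `|conv (1 - rho) n| <= C * rho * n%:R.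
Proof.
have r1 := golden_ratio_gt1 R; have rr := golden_ratio_sqr R.
elim: n => [|n IH]; first by rewrite /conv big_ord0 normr0 mulr0.
rewrite convS normrM distrC (ger0_norm (_ : 0 <= rho - 1)); last by lra.
have /andP[L0 LC] := L_bnd n.+1.
have : `|conv (1 - rho) n + L n.+1| <= C * rho * n%:R + n.+1%:R * C.
  by rewrite (le_trans (ler_normD _ _))// lerD// ger0_norm.
move=> /(ler_wpM2l (_ : 0 <= rho - 1)); move=> /(_ ltac:(lra)) /le_trans; apply.
(* Since [(rho - 1) (rho + 1) = rho^2 - 1 = rho], the slope [C * rho] reproduces itself. *)
rewrite -natr1 [leLHS](_ : _ = C * n%:R * (rho ^+ 2 - 1) + C * (rho - 1)); last by ring.
rewrite rr; have := C_ge0; lra.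
Qed.

(** The terms are nonnegative and at most [C * i / rho ^+ i], whose partial sums stay below
    [rho ^+ 3 * C]. *)
Lemma cvg_golden_series :
  cvgn (fun n => \sum_(1 <= i < n.+1) L i / rho ^+ (i + 3)).
Proof.
have r0 := golden_ratio_gt0 R.
apply: nondecreasing_is_cvgn.
  apply/nondecreasing_seqP => n /=.
  rewrite [leRHS]big_nat_recr//= lerDl.
  by have /andP[L0 _] := L_bnd n.+1; rewrite divr_ge0// exprn_ge0// ltW.
exists (rho ^+ 3 * C) => _ [n _ <-] /=.
rewrite big_add1 big_mkord.
apply: le_trans (ler_wpM2r C_ge0 (sum_mulrn_golden_le R n)).
rewrite big_distrl /=; apply: ler_sum => k _; rewrite mulrAC.
have /andP[L0 LC] := L_bnd k.+1; apply: ler_pM => //.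
  by rewrite invr_ge0 exprn_ge0// ltW.
rewrite lef_pV2 ?posrE ?exprn_gt0// ler_weXn2l ?leq_addr// ltW//.
exact: golden_ratio_gt1.
Qed.

Lemma fib_conv n : \sum_(k < n) L (n - k)%N *+ fib k.+1 =
  (conv rho n - conv (1 - rho) n) / (2 * rho - 1).
Proof.
have d0 : 2 * rho - 1 != 0.
  by rewrite gt_eqF//; have := golden_ratio_gt1 R; lra.
apply: (mulIf d0); rewrite mulfVK// -sumrB big_distrl /=; apply: eq_bigr => k _.
by rewrite -mulrBl -binet -mulr_natr; ring.
Qed.

Lemma cvg_card_ball :
  (fun n => (#|Defs.ball n|%:R : R) / rho ^+ (n + 4)) @ \oo -->
  (2 * rho - 1)^-1.
Proof.
have fib4 n : (2 <= fib n.+4)%N.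
  by elim: n => // n IH; rewrite fibSS; lia.
rewrite (_ : (fun _ => _) = fun n : nat => (fib (n + 4))%:R / rho ^+ (n + 4) -
    2 * (rho ^+ (n + 4))^-1); last first.
  apply/funext => n; rewrite card_ball -mulrBl addn4 -subn2 natrB//.
rewrite -[X in _ --> X]subr0; apply: cvgB.
  rewrite (cvg_shiftn 4 (fun n => (fib n)%:R / rho ^+ n : R)).
  exact: cvg_fib.
rewrite -[X in _ --> X](mulr0 2); apply: cvgMr.
rewrite (cvg_shiftn 4 (fun n => (rho ^+ n)^-1 : R)).
exact: cvg_expr_golden0.
Qed.

End ConvolutionAsymptotics.

(** * Limits of the entropy sequences of the two axial products *)

Lemma ln_words_bnd (R : realType) (A : finType) (X : set (nat -> A)) m :
  X !=set0 -> 0 <= ln (#|words X m|%:R : R) <= m%:R * ln (#|A|%:R : R).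
Proof.
move=> X_neq0; have w0 := card_words_gt0 m X_neq0.
rewrite ln_ge0 ?ler1n//=; have [y0 Xy0] := X_neq0.
have A0 : (0 < #|A|)%N by apply/card_gt0P; exists (y0 0%N).
rewrite mulr_natl -lnXn ?ltr0n// ler_ln ?posrE ?exprn_gt0 ?ltr0n//.
by rewrite -natrX ler_nat -card_tuple max_card.
Qed.

Section Entropy.
Variables (R : realType) (A : finType) (X : set (nat -> A)).
Hypotheses (X_neq0 : X !=set0) (X_shift : @left_shift A @` X `<=` X).
Local Notation rho := (golden_ratio R).
Local Notation L := (fun m => ln (#|words X m|%:R : R)).

Lemma axial_product_setT_l :
  axial_product [set: nat -> A] X = chain_product f2 X.
Proof.
have [y0 _] := X_neq0; rewrite axial_productE//; last by exists y0.
by rewrite (chain_productT (y0 0%N)) setTI.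
Qed.

Lemma axial_product_setT_r :
  axial_product X [set: nat -> A] = chain_product f1 X.
Proof.
have [y0 _] := X_neq0; rewrite axial_productE//.
by rewrite (chain_productT (y0 0%N)) setIT.
Qed.

(** The [fib (n + 1)] heads of length [n] keep one vertex in the ball, the [fib (n + 2) - 1] shorter
    ones keep two. Against a ball of size [fib (n + 4) - 2] these give the weights [rho^-3] and
    [rho^-2]. *)
Lemma cvg_entropy_setT_l :
  entropy_seq R (axial_product [set: nat -> A] X) @ \oo -->
  L 1%N / rho ^+ 3 + L 2%N / rho ^+ 2.
Proof.
have r0 := golden_ratio_neq0 R.
have d0 : 2 * rho - 1 != 0.
  by rewrite gt_eqF//; have := golden_ratio_gt1 R; lra.
have cvg_shift_fib a : (a <= 4)%N ->
    (fun n => (fib (n + a))%:R / rho ^+ (n + 4) : R) @ \oo -->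
    (2 * rho - 1)^-1 / rho ^+ (4 - a).
  move=> a4; rewrite (_ : (fun _ => _) = fun n => (fib (n + a))%:R /
      rho ^+ (n + a) / rho ^+ (4 - a)); last first.
    by apply/funext => n; rewrite -mulrA -invfM -exprD -addnA subnKC.
  apply: cvgMl; rewrite (cvg_shiftn a (fun n => (fib n)%:R / rho ^+ n : R)).
  exact: cvg_fib.
rewrite axial_product_setT_l.
rewrite (_ : entropy_seq R _ = fun n : nat =>
  (L 1%N * ((fib (n + 1))%:R / rho ^+ (n + 4)) +
   L 2%N * ((fib (n + 2))%:R / rho ^+ (n + 4) - (rho ^+ (n + 4))^-1)) /
   (#|Defs.ball n|%:R / rho ^+ (n + 4))); last first.
  apply/funext => n; rewrite /entropy_seq ln_card_patterns// big_ord_recr/=.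
  rewrite /chain_len /= subSnn count_gwords2.
  under eq_bigr => k _.
    rewrite count_gwords2 (_ : minn 2 (n.+1 - k) = 2)%N; last first.
      by have := ltn_ord k; lia.
    over.
  rewrite sumrMnr sum_fib -subn1 mulrnBr; last first.
    by elim: n => // n IH; rewrite fibSS; lia.
  rewrite addn1 addn2 mulr1n -mulr_natr -[X in _ + X]mulr_natr.
  set w := rho ^+ _; have w0 : w != 0 by rewrite expf_neq0.
  have b0 : #|Defs.ball n|%:R != 0 :> R by rewrite pnatr_eq0 -lt0n card_ball_gt0.
  by field; rewrite b0 w0.
(* The factor [(2 * rho - 1)^-1] comes from Binet's formula in both numerator and ball size, and
   cancels. *)
rewrite (_ : L 1%N / rho ^+ 3 + L 2%N / rho ^+ 2 =
  (L 1%N * ((2 * rho - 1)^-1 / rho ^+ (4 - 1)) +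
   L 2%N * ((2 * rho - 1)^-1 / rho ^+ (4 - 2) - 0)) / (2 * rho - 1)^-1); last first.
  by rewrite !subSS !subn0; field; rewrite d0 r0.
apply: cvgM; last by apply: cvgV; [rewrite invr_eq0|exact: cvg_card_ball].
apply: cvgD; first by apply: cvgMr; exact: cvg_shift_fib.
apply: cvgMr; apply: cvgB; first exact: cvg_shift_fib.
rewrite (cvg_shiftn 4 (fun n => (rho ^+ n)^-1 : R)).
exact: cvg_expr_golden0.
Qed.

(** After division by [rho ^+ (n + 4)], the chain of the root and the conjugate convolution vanish;
    only the partial sums of the series survive. *)
Lemma cvg_entropy_setT_r (v : R) :
  (fun n => \sum_(1 <= i < n.+1) L i / rho ^+ (i + 3)) @ \oo --> v ->
  entropy_seq R (axial_product X [set: nat -> A]) @ \oo --> v.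
Proof.
move=> Lv; have r0 := golden_ratio_neq0 R.
have rgt0 := golden_ratio_gt0 R.
have d0 : 2 * rho - 1 != 0.
  by rewrite gt_eqF//; have := golden_ratio_gt1 R; lra.
pose C : R := ln #|A|%:R.
have Lb m : 0 <= L m <= m%:R * C := ln_words_bnd R m X_neq0.
have C0 : 0 <= C.
  by have /andP[L0 /(le_trans L0)] := Lb 1%N; rewrite mul1r.
(* Both error terms grow at most linearly, so one estimate covers them. *)
have err0 (u : nat -> R) (K : R) : (forall n, `|u n| <= K * n.+1%:R) ->
    (fun n => u n / rho ^+ (n + 4)) @ \oo --> (0 : R).
  move=> uK; apply/norm_cvg0P.
  have g0 : (fun n => K / rho ^+ 3 * (n.+1%:R / rho ^+ n.+1) : R) @ \oo --> (0 : R).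
    rewrite -[X in _ --> X](mulr0 (K / rho ^+ 3)); apply: cvgMr.
    rewrite (cvg_shiftS (fun n => n%:R / rho ^+ n : R)).
    exact: cvg_natr_golden.
  apply: (squeeze_cvgr _ (cvg_cst 0) g0); apply: nearW => n.
  rewrite normr_ge0 /= normrM normfV (ger0_norm (exprn_ge0 _ (ltW rgt0))).
  rewrite mulrACA -invfM -exprD (_ : 3 + n.+1 = n + 4)%N; last by lia.
  by rewrite ler_wpM2r// invr_ge0 exprn_ge0// ltW.
rewrite axial_product_setT_r.
rewrite (_ : entropy_seq R _ = fun n : nat =>
  (L n.+1 / rho ^+ (n + 4) +
   (\sum_(1 <= i < n.+1) L i / rho ^+ (i + 3) -
    conv L (1 - rho) n / rho ^+ (n + 4)) / (2 * rho - 1)) /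
   (#|Defs.ball n|%:R / rho ^+ (n + 4))); last first.
  (* The root is split off: it is the only head of length 0, and its chain has [n.+1] vertices in
     the ball. *)
  apply/funext => n; rewrite /entropy_seq ln_card_patterns// big_ord_recl/=.
  rewrite /chain_len /= subn0 mulr1n.
  under eq_bigr do rewrite count_gwords1 /bump add1n subSS add0n.
  rewrite (fib_conv L) conv_golden.
  set w := rho ^+ _; have w0 : w != 0 by rewrite expf_neq0.
  set S := \sum_(_ <= _ < _) _.
  have b0 : #|Defs.ball n|%:R != 0 :> R by rewrite pnatr_eq0 -lt0n card_ball_gt0.
  by field; rewrite b0 w0 d0.
rewrite (_ : v = (0 + (v - 0) / (2 * rho - 1)) / (2 * rho - 1)^-1); last first.
  by field.
apply: cvgM; last by apply: cvgV; [rewrite invr_eq0|exact: cvg_card_ball].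
apply: cvgD.
  apply: (err0 _ C) => n; have /andP[L0 LC] := Lb n.+1.
  by rewrite ger0_norm// mulrC.
apply: cvgMl; apply: cvgB => //; apply: (err0 _ (C * rho)) => n.
apply: le_trans (norm_conv_conj C0 Lb n) _.
by rewrite ler_wpM2l ?mulr_ge0 ?ler_nat// ltW.
Qed.

End Entropy.

Theorem theorem4p1 (R : realType) (A : finType) (X : set (nat -> A))
    (subshiftX : subshift X) (X_neq0 : X !=set0) :
  let E := [set: nat -> A] in
  let rho := golden_ratio R in
  (cvgn (entropy_seq R (axial_product E X)) /\
   entropy R (axial_product E X) =
     ln #|words X 1|%:R / rho ^+ 3 + ln #|words X 2|%:R / rho ^+ 2) /\
  (cvgn (entropy_seq R (axial_product X E)) /\
   (fun n => \sum_(1 <= i < n.+1) ln #|words X i|%:R / rho ^+ (i + 3)) @ \oo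
     --> entropy R (axial_product X E)).
Proof.
move=> E rho; have [_ X_shift] := subshiftX.
have cvgEX := @cvg_entropy_setT_l R A X X_neq0 X_shift.
have C0 : 0 <= ln (#|A|%:R : R).
  have /andP[L0 /(le_trans L0)] := ln_words_bnd R 1 X_neq0.
  by rewrite mul1r.
have Lcvg := cvg_golden_series C0 (fun m => ln_words_bnd R m X_neq0).
have cvgXE := cvg_entropy_setT_r X_neq0 X_shift Lcvg.
split; split.
- exact: cvgP cvgEX.
- exact: cvg_lim cvgEX.
- exact: cvgP cvgXE.
- by rewrite /entropy (cvg_lim _ cvgXE).
Qed.
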